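(* Let $1\le L\le N$ be integers and let $\mathbf{w}\in\{0,1\}^N$ be a binary pilot mask with exactly $L$ entries equal to $1$. Let $h(q)=\sum_{n=0}^{N-1}w_nw_{\langle n-q\rangle_N}$ and $\mathcal{D}_h=\{q\in\mathbb{Z}_N:\ q\neq 0,\ h(q)=L\}$. Then for any $q\in\mathbb{Z}_N$, $q$ and $\langle q+1\rangle_N$ both belong to $\mathcal{D}_h\cup\{0\}$ only when $L=N$.
   Context: $\mathbb{Z}_N=\{0,1,\dots,N-1\}$; $\langle\cdot\rangle_N$ denotes reduction modulo $N$; vectors are indexed from $0$. ($\mathcal{D}_h$ is the set of nonzero Doppler indices at which the mask $\mathbf{w}$ is invariant under cyclic shift.) *)

(* Defs.v *)
(* MathComp *)
From mathcomp Require Import all_boot.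

Set Implicit Arguments.
Unset Strict Implicit.
Unset Printing Implicit Defensive.

(* Z_N is 'I_N; the library's [ordS q] has value q.+1 %% N, i.e. <q + 1>_N. *)

(* <n - q>_N: since q < N, the natural number n + (N - q) is congruent to the
   integer n - q modulo N, which avoids truncated subtraction. *)
Definition ord_subm (N : nat) (n q : 'I_N) : 'I_N :=
  Ordinal (ltn_pmod (n + (N - q)) (leq_ltn_trans (leq0n n) (ltn_ord n))).

(* A binary mask is {ffun 'I_N -> bool}, with true = 1 and false = 0; the
   products below are in nat via the coercion of bool to nat. *)
Definition autocorr (N : nat) (w : {ffun 'I_N -> bool}) (q : 'I_N) : nat :=
  \sum_(n < N) w n * w (ord_subm n q).

Definition Dh (N L : nat) (w : {ffun 'I_N -> bool}) : {set 'I_N} :=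
  [set q : 'I_N | (val q != 0) && (autocorr w q == L)].

(* The singleton {0}; 'I_N has no canonical zero for an abstract N, which may
   a priori be 0. *)
Definition zero_set (N : nat) : {set 'I_N} := [set q : 'I_N | val q == 0].

(* Main.v *)
(* If h(q) = L then the support S of w satisfies S - q = S: the shift by q maps S
   injectively into itself. If q + 1 is also such a shift, then n + 1 in S gives
   (n + 1) - (q + 1) = n - q in S, hence n in S. So S is stable under predecessor,
   and being nonempty it is all of Z_N. *)
Require Import Defs.
From mathcomp Require Import all_boot.

Lemma modn_modDS (N a : nat) : ((a %% N).+1 = a.+1 %[mod N]).
Proof. by rewrite -addn1 modnDml addn1. Qed.

Lemma ord_subm_inj (N : nat) (q : 'I_N) : injective (fun n => ord_subm n q).
Proof.
move=> m n /(congr1 val) /= /eqP; rewrite eqn_modDr !modn_small //.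
by move/eqP/val_inj.
Qed.

Lemma ord_subm_zero (N : nat) (n q : 'I_N) : val q = 0 -> ord_subm n q = n.
Proof. by move=> q0; apply/val_inj; rewrite /= q0 subn0 modnDr modn_small. Qed.

Lemma ord_subm_ordS (N : nat) (n q : 'I_N) :
  ord_subm (ordS n) (ordS q) = ord_subm n q.
Proof.
apply/val_inj => /=; rewrite modnDml.
(* At [q = N - 1] the successor wraps to 0, so [N - ordS q] is [N] rather than 0; the extra [N]
   vanishes modulo [N]. *)
have := ltn_ord q; rewrite leq_eqVlt => /orP[/eqP qN|qN].
  rewrite qN modnn subn0 modnDr; congr (_ %% _).
  by rewrite -addn1 -(subSnn q) qN.
by rewrite (modn_small qN) addSnnS subnSK.
Qed.

Lemma val_iter_ordS (N k : nat) (n : 'I_N) : val (iter k (@ordS N) n) = (n + k) %% N.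
Proof.
elim: k => [|k IHk]; first by rewrite addn0 modn_small.
by rewrite iterS /= IHk modn_modDS addnS.
Qed.

Lemma ordS_iter_onto (N : nat) (m n : 'I_N) : exists k, iter k (@ordS N) m = n.
Proof.
(* [N - m] steps lead from [m] around to 0, and [n] more lead to [n]. *)
exists (N - m + n); apply/val_inj; rewrite val_iter_ordS addnA subnKC 1?ltnW //.
by rewrite modnDl modn_small.
Qed.

(** As a cardinality, [h(q) = L] becomes the equality case of an inclusion of finite sets. *)
Lemma autocorr_card (N : nat) (w : {ffun 'I_N -> bool}) (q : 'I_N) :
  autocorr w q = #|[set n | w n && w (ord_subm n q)]|.
Proof.
rewrite cardsE -sum1_card [RHS]big_mkcond; apply: eq_bigr => n _.
by rewrite mulnb unfold_in; case: (_ && _).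
Qed.

Lemma shift_invariant (N : nat) (w : {ffun 'I_N -> bool}) (q : 'I_N) :
  q \in Dh #|[set n | w n]| w :|: zero_set N ->
  forall n, w (ord_subm n q) = w n.
Proof.
rewrite !inE => /orP[/andP[_ /eqP hq]|/eqP q0] n; last by rewrite ord_subm_zero.
have sub : [set n | w n && w (ord_subm n q)] = [set n | w n].
  apply/eqP; rewrite eqEcard -autocorr_card hq leqnn andbT.
  by apply/subsetP => m; rewrite !inE => /andP[].
(* By [sub] the shift keeps the support inside itself; injectivity makes the sizes equal. *)
have img : [set ord_subm m q | m in [set n | w n]] = [set n | w n].
  apply/eqP; rewrite eqEcard (card_imset _ (ord_subm_inj N q)) leqnn andbT.
  by apply/subsetP => _ /imsetP[m + ->]; rewrite -{1}sub !inE => /andP[].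
(* By injectivity, [ord_subm n q] lies in the image exactly when [n] lies in the support, so [img]
   gives both directions at once. *)
have := mem_imset [set n | w n] n (ord_subm_inj N q).
by rewrite img !inE.
Qed.

Theorem corollary3 (N L : nat) (hL1 : 1 <= L) (hLN : L <= N)
    (w : {ffun 'I_N -> bool}) (hw : #|[set n : 'I_N | w n]| = L) (q : 'I_N) :
  q \in Dh L w :|: zero_set N ->
  ordS q \in Dh L w :|: zero_set N ->
  L = N.
Proof.
rewrite -hw => /shift_invariant wq /shift_invariant wSq.
(* Shift [n + 1] by [q + 1], then undo the shift by [q]. *)
have wS n : w (ordS n) = w n by rewrite -wSq ord_subm_ordS wq.
have [m] : exists m, m \in [set n | w n] by apply/card_gt0P; rewrite hw.
rewrite inE => wm.
have -> : [set n | w n] = [set: 'I_N].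
  apply/setP => n; rewrite !inE; have [k <-] := ordS_iter_onto N m n.
  by elim: k => [|k IHk] //; rewrite iterS wS.
by rewrite cardsT card_ord.
Qed.
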